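(* Let $G=(V,E)$ be a finite simple graph and let $\lambda\in\mathbb{Z}_{>0}^V$. There exists a unique polynomial $\widetilde{\chi}_G^\lambda(q,x)\in\mathbb{Q}(q)[x]$ such that \[ \widetilde{\chi}_G^\lambda(q,[n]_q) \;=\; \chi_G^\lambda(q,n)\qquad\text{for all } n\in\mathbb{Z}_{>0}, \] where $[n]_q:=\frac{1-q^n}{1-q}$.
   Context: For a positive integer $n$, $[n]=\{1,\dots,n\}$. A coloring $c:V\to[n]$ is proper if $c(v)\neq c(w)$ whenever $vw\in E$. The $q$-chromatic function is \[ \chi_G^\lambda(q,n):=\sum_{\substack{\text{proper colorings}\\ c:V\to[n]}} q^{\sum_{v\in V}\lambda_v c(v)} . \] *)

(* Defs.v *)
From HB Require Import structures.
From mathcomp Require Import all_boot all_order all_algebra.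

Set Implicit Arguments.
Unset Strict Implicit.
Unset Printing Implicit Defensive.

Import GRing.Theory.
Local Open Scope ring_scope.

(* The field Q(q), with q the class of the polynomial variable. *)
Definition Qq : fieldType := {fraction {poly rat}}.

Definition q : Qq := tofrac ('X : {poly rat}).

Definition qint (n : nat) : Qq := (1 - q ^+ n) / (1 - q).

Definition simple_graph (V : finType) (adj : rel V) : Prop :=
  symmetric adj /\ irreflexive adj.

(* The color set [n] = {1, ..., n} is encoded by 'I_n = {0, ..., n - 1}; the
   ordinal i stands for the color i + 1. *)
Definition color (n : nat) (i : 'I_n) : nat := i.+1.

Definition proper_coloring (V : finType) (adj : rel V) (n : nat)
    (c : {ffun V -> 'I_n}) : bool :=
  [forall v, forall w, adj v w ==> (c v != c w)].

Definition q_chromatic (V : finType) (adj : rel V) (lam : V -> nat)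
    (n : nat) : Qq :=
  \sum_(c : {ffun V -> 'I_n} | proper_coloring adj c)
    q ^+ (\sum_(v : V) lam v * color (c v))%N.

(* Main.v *)
(** Fix the set [W] of vertices to be colored. Removing the class [S] of the
    largest color from a coloring of [W] with [n+1] colors gives
      [f_W(n+1) = f_W(n) + sum_S q^((n+1) lam(S)) f_(W \ S)(n)],
    where [S] ranges over the nonempty stable subsets of [W]. If every
    [f_(W \ S)(n)] is a polynomial in [q^n], then so is [f_W(n+1) - f_W(n)], and
    its constant term vanishes because [lam(S) > 0]; such a function sums to a
    polynomial in [q^n] since [sum_(m < n) q^(k m) = (q^(k n) - 1) / (q^k - 1)]
    for [k > 0]. Finally [q^n = 1 - (1 - q) [n]_q]. *)
Require Import Defs.
From HB Require Import structures.
From mathcomp Require Import all_boot all_order all_algebra.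

Set Implicit Arguments.
Unset Strict Implicit.
Unset Printing Implicit Defensive.

Import GRing.Theory.
Local Open Scope ring_scope.

(** The spare value 0 puts the colorings of every [W] in one function type, so deleting vertices
    leaves the domain unchanged. An edge leaving [W] imposes nothing, as 0 differs from every color
    used on [W]. *)
Definition partial_coloring (V : finType) (adj : rel V) (W : {set V}) (n : nat)
    (c : {ffun V -> 'I_n.+1}) : bool :=
  [forall v, ((c v == ord0) == (v \notin W)) &&
             [forall w, adj v w && (v \in W) ==> (c v != c w)]].

Definition stable (V : finType) (adj : rel V) (S : {set V}) : bool :=
  [forall v in S, forall w in S, ~~ adj v w].

(* Color 0 marks the vertices outside [W]; it has weight 0. *)
Definition partial_chromatic (F : fieldType) (z : F) (V : finType)
    (adj : rel V) (lam : V -> nat) (W : {set V}) (n : nat) : F :=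
  \sum_(c : {ffun V -> 'I_n.+1} | partial_coloring adj W c)
    z ^+ (\sum_(v : V) lam v * c v)%N.

Definition add_top_color (V : finType) (S : {set V}) (n : nat)
    (c : {ffun V -> 'I_n.+1}) : {ffun V -> 'I_n.+2} :=
  [ffun v => if v \in S then ord_max else inord (c v)].

Definition erase_color (V : finType) (S : {set V}) (n : nat)
    (c : {ffun V -> 'I_n.+2}) : {ffun V -> 'I_n.+1} :=
  [ffun v => if v \in S then ord0 else inord (c v)].

Lemma partial_coloringP (V : finType) (adj : rel V) (W : {set V}) (n : nat)
    (c : {ffun V -> 'I_n.+1}) :
  reflect ((forall v, (c v == 0%N :> nat) = (v \notin W)) /\
           (forall v w, adj v w -> v \in W -> c v != c w :> nat))
          (partial_coloring adj W c).
Proof.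
apply: (iffP forallP) => [H|[H1 H2] v].
  split=> [v|v w vw vW]; have /andP[/eqP H1 /forallP H2] := H v; first exact: H1.
  by have := H2 w; rewrite vw vW.
apply/andP; split; first by apply/eqP; exact: H1.
by apply/forallP=> w; apply/implyP=> /andP[vw vW]; exact: H2.
Qed.

Section TopColor.
Variables (V : finType) (adj : rel V) (n : nat).
Implicit Types (W S : {set V}) (c : {ffun V -> 'I_n.+1}).

Lemma add_top_colorE S c v :
  add_top_color S c v = (if v \in S then n.+1 else c v) :> nat.
Proof.
rewrite ffunE; case: ifP => // _.
by rewrite inordK // ltnS ltnW.
Qed.

(** The values of [c] on [S] are overwritten, so the round trip can only restore zeros there. *)
Lemma add_top_colorK S c :
  (erase_color S (add_top_color S c) == c) = [forall v in S, c v == ord0].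
Proof.
apply/eqP/forall_inP => [H v vS|H].
  by rewrite -H ffunE vS.
apply/ffunP=> v; rewrite ffunE add_top_colorE; have [vS|_] := boolP (v \in S).
  by rewrite (eqP (H v vS)).
by rewrite inord_val.
Qed.

Lemma erase_colorK (c : {ffun V -> 'I_n.+2}) :
  let S := [set v | c v == ord_max] in
  add_top_color S (erase_color S c) = c.
Proof.
move=> S; apply/ffunP=> v; apply/val_inj; rewrite /= add_top_colorE inE.
case: eqP => [->//|/eqP cvN].
rewrite ffunE inE (negPf cvN) inordK // ltn_neqAle -ltnS ltn_ord andbT.
by move: cvN; rewrite -val_eqE.
Qed.

Lemma top_class_add_top_color S c :
  [set v | add_top_color S c v == ord_max] = S.
Proof.
apply/setP=> v; rewrite inE -val_eqE /= add_top_colorE.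
by case: (v \in S); rewrite ?eqxx // ltn_eqF.
Qed.

(** The left side is the side condition that reindexing by [add_top_color] creates. The top color is
    nonzero, which forces [S] into [W]; it is shared on [S], which forces stability; it exceeds all
    other colors, so edges between [S] and the rest are harmless. *)
Lemma partial_coloring_add_top W S c :
  partial_coloring adj W (add_top_color S c) && [forall v in S, c v == ord0] =
  [&& S \subset W, stable adj S & partial_coloring adj (W :\: S) c].
Proof.
apply/andP/and3P.
  case=> /partial_coloringP[H1 H2] /forall_inP H0.
  have SW : S \subset W.
    by apply/subsetP=> v vS; have := H1 v; rewrite add_top_colorE vS; case: (v \in W).
  split=> //.
    apply/forall_inP=> v vS; apply/forall_inP=> w wS; apply/negP=> vw.
    have := H2 v w vw (subsetP SW v vS).
    by rewrite !add_top_colorE vS wS eqxx.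
  apply/partial_coloringP; split=> [v|v w vw].
    rewrite inE negb_and negbK; case: (boolP (v \in S)) => [vS|vNS].
      by rewrite (eqP (H0 v vS)).
    by rewrite -(H1 v) add_top_colorE (negPf vNS).
  rewrite inE => /andP[vNS vW]; have := H2 v w vw vW.
  rewrite !add_top_colorE (negPf vNS); case: ifP => // wS _.
  rewrite (eqP (H0 w wS)) /=.
  by have := H1 v; rewrite vW add_top_colorE (negPf vNS) => ->.
case=> SW /forall_inP stS /partial_coloringP[H1 H2]; split.
  apply/partial_coloringP; split=> [v|v w vw vW]; rewrite !add_top_colorE.
    case: ifP => vS; first by rewrite (subsetP SW).
    by rewrite H1 inE vS.
  case: ifP => vS; case: ifP => wS.
  - by have /forall_inP/(_ w wS) := stS v vS; rewrite vw.
  - by rewrite gtn_eqF.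
  - by rewrite ltn_eqF.
  - by apply: H2; rewrite // inE vS.
by apply/forall_inP=> v vS; rewrite -val_eqE /= H1 inE vS.
Qed.

End TopColor.

Section Recurrence.
Variables (F : fieldType) (z : F) (V : finType) (adj : rel V) (lam : V -> nat).

Local Notation f := (partial_chromatic z adj lam).

Lemma partial_chromatic_top_class (W S : {set V}) n :
  \sum_(c : {ffun V -> 'I_n.+2} | partial_coloring adj W c &&
                                  ([set v | c v == ord_max] == S))
    z ^+ (\sum_v lam v * c v)%N =
  if (S \subset W) && stable adj S
  then z ^+ (n.+1 * \sum_(v in S) lam v) * f (W :\: S) n else 0.
Proof.
rewrite (reindex_onto (@add_top_color V S n) (@erase_color V S n)); last first.
  by move=> c /andP[_ /eqP <-]; exact: erase_colorK.
under eq_bigl => c do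
  rewrite top_class_add_top_color eqxx andbT add_top_colorK
          partial_coloring_add_top andbA.
case: ifP => _; last by rewrite big_pred0.
rewrite /partial_chromatic mulr_sumr; apply: eq_bigr => c /partial_coloringP[H _].
rewrite -exprD; congr (_ ^+ _); rewrite big_distrr [in RHS]big_mkcond -big_split /=.
apply: eq_bigr => v _; rewrite add_top_colorE.
case: ifP => vS //.
(* On [S] the whole weight comes from the top color, since [c] is 0 outside [W :\: S]. *)
have -> : c v = 0%N :> nat by apply/eqP; rewrite H inE vS.
by rewrite muln0 addn0 mulnC.
Qed.

Lemma partial_chromaticS (W : {set V}) n :
  f W n.+1 = f W n +
    \sum_(S : {set V} | [&& S \subset W, stable adj S & S != set0])
      z ^+ (n.+1 * \sum_(v in S) lam v) * f (W :\: S) n.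
Proof.
rewrite {1}/partial_chromatic
  (partition_big (fun c : {ffun V -> 'I_n.+2} => [set v | c v == ord_max]) predT) //=.
under eq_bigr => S _ do rewrite partial_chromatic_top_class.
(* The empty top class accounts for the colorings that avoid [n.+1], that is, for [f W n]. *)
rewrite -big_mkcond (bigD1 set0) /=; last first.
  by rewrite sub0set; apply/forall_inP=> v; rewrite inE.
rewrite big_set0 muln0 expr0 mul1r setD0; congr (_ + _).
by apply: eq_bigl => S; rewrite andbA.
Qed.

(** With every vertex colored the marker 0 never occurs, and [lift ord0] shifts the ordinals to the
    actual colors. *)
Lemma partial_chromatic_setT n :
  f setT n.+1 = \sum_(c : {ffun V -> 'I_n.+1} | proper_coloring adj c)
                  z ^+ (\sum_v lam v * color (c v))%N.
Proof.
pose h (c : {ffun V -> 'I_n.+1}) : {ffun V -> 'I_n.+2} := [ffun v => lift ord0 (c v)].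
pose h' (c : {ffun V -> 'I_n.+2}) : {ffun V -> 'I_n.+1} := [ffun v => inord (c v).-1].
rewrite /partial_chromatic (reindex_onto h h') /=; last first.
  move=> c /partial_coloringP[H _]; apply/ffunP=> v; apply/val_inj; rewrite !ffunE /=.
  have cv : (0 < c v)%N by rewrite lt0n H inE.
  have lt_cv : ((c v).-1 < n.+1)%N by rewrite prednK // -ltnS ltn_ord.
  by rewrite inordK // /bump add1n prednK.
apply: eq_big => [c|c _]; last first.
  by congr (_ ^+ _); apply: eq_bigr => v _; rewrite ffunE.
have -> : h' (h c) == c.
  by apply/eqP/ffunP=> v; rewrite !ffunE lift0 inord_val.
rewrite andbT; apply: eq_forallb => v; rewrite !ffunE inE /=.
by apply: eq_forallb => w; rewrite andbT !ffunE (inj_eq lift_inj).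
Qed.

End Recurrence.

Section PolynomialInPowers.
Variables (F : fieldType) (z : F).
Hypothesis z_exp_neq1 : forall n, (0 < n)%N -> z ^+ n != 1.

(** The factor ['X] rules out a constant term, whose sum would be linear in [n]; each remaining
    power sums geometrically. *)
Lemma indefinite_sum_poly (f : nat -> F) (g : {poly F}) :
  (forall n, f n.+1 = f n + (g * 'X).[z ^+ n]) ->
  exists p : {poly F}, forall n, f n = p.[z ^+ n].
Proof.
move=> fS.
(* At [z ^+ n], the term of index [k] is the closed form of the sum of [g_k z^((k+1)m)] over
   [m < n]. *)
pose P := \sum_(k < size g) (g`_k / (z ^+ k.+1 - 1)) *: ('X^(k.+1) - 1).
exists (P + (f 0)%:P) => n; elim: n => [|n IH].
  rewrite expr0 hornerD hornerC horner_sum big1 ?add0r // => k _.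
  by rewrite !hornerE expr1n subrr mulr0.
rewrite fS IH !hornerD !hornerC addrAC; congr (_ + _).
rewrite !horner_sum hornerMX horner_coef mulr_suml -big_split /=.
apply: eq_bigr => k _; rewrite !hornerE.
have nz : z ^+ k.+1 - 1 != 0 by rewrite subr_eq0 z_exp_neq1.
rewrite -[_ * z ^+ n]mulrA -exprSr -{2}(divfK nz g`_k) -!mulrA -!mulrDr; congr (_ * (_ * _)).
by rewrite -!exprM mulSn exprD mulrBl mul1r addrC addrA subrK.
Qed.

Lemma partial_chromatic_poly (V : finType) (adj : rel V) (lam : V -> nat)
    (W : {set V}) :
  (forall v, (0 < lam v)%N) ->
  exists p : {poly F}, forall n, partial_chromatic z adj lam W n = p.[z ^+ n].
Proof.
move=> lam_gt0; have [m] := ubnP #|W|; elim: m W => // m IH W; rewrite ltnS => leWm.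
pose A (S : {set V}) := [&& S \subset W, stable adj S & S != set0].
have [p pP] : exists p : {set V} -> {poly F}, forall S, A S -> forall n,
    partial_chromatic z adj lam (W :\: S) n = (p S).[z ^+ n].
  apply: (@fin_all_exists _ _ (fun S p => A S -> forall n,
    partial_chromatic z adj lam (W :\: S) n = p.[z ^+ n])) => S.
  (* Sets outside [A] do not enter the recurrence, so 0 is a filler. *)
  have [|NA] := boolP (A S); last by exists 0.
  case/and3P=> SW _ S0; have [|p pP] := IH (W :\: S); last by exists p.
  apply: leq_trans leWm; apply: proper_card.
  rewrite properE subsetDl; apply/negP=> /subsetP sub.
  case/set0Pn: S0 => v vS; have := sub v (subsetP SW v vS).
  by rewrite inE vS.
pose l (S : {set V}) := (\sum_(v in S) lam v)%N.
(* Since [z^((n+1)l) = z^l (z^n)^l], one of the [l] factors [z^n] supplies the required ['X]; this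
   uses [l S > 0]. *)
apply: (@indefinite_sum_poly _ (\sum_(S | A S) z ^+ l S *: ('X^((l S).-1) * p S))) => n.
rewrite partial_chromaticS; congr (_ + _).
rewrite hornerMX horner_sum mulr_suml; apply: eq_bigr => S AS.
have lS : (0 < l S)%N.
  case/and3P: AS => _ _ /set0Pn[v vS].
  by rewrite /l (bigD1 v) //= addn_gt0 lam_gt0.
rewrite pP // -/(l S) !hornerE mulSn exprD -!mulrA; congr (_ * _).
by rewrite [_ * z ^+ n]mulrC mulrA -exprSr prednK // -exprM.
Qed.

End PolynomialInPowers.

(** A nonzero difference would have [size (p - r)] distinct roots, one more than its degree. *)
Lemma poly_eq_on_injective_seq (F : fieldType) (u : nat -> F) (p r : {poly F}) :
  injective u -> (forall n, p.[u n] = r.[u n]) -> p = r.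
Proof.
move=> u_inj pr; apply/eqP; rewrite -subr_eq0; apply/negPn/negP=> nz.
have := @max_poly_roots _ (p - r) [seq u i | i <- iota 0 (size (p - r))] nz.
rewrite size_map size_iota ltnn map_inj_uniq // iota_uniq => H.
suff: false by []; apply: H => //.
by apply/allP=> _ /mapP[i _ ->]; rewrite /root !hornerE pr subrr.
Qed.

Lemma q_exp_inj : injective (fun n => q ^+ n).
Proof.
move=> m n /eqP; rewrite /q -!tofracXn tofrac_eq => /eqP H.
by have := congr1 (fun p : {poly rat} => size p) H; rewrite !size_polyXn => -[].
Qed.

Lemma q_exp_neq1 n : (0 < n)%N -> q ^+ n != 1.
Proof.
by move=> n_gt0; rewrite -[1](expr0 q) (inj_eq q_exp_inj) -lt0n.
Qed.

Lemma q_exp_qint n : q ^+ n = 1 - (1 - q) * qint n.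
Proof.
have nz : 1 - q != 0 by rewrite subr_eq0 eq_sym -[q]expr1 q_exp_neq1.
by rewrite /qint mulrC divfK // subKr.
Qed.

Theorem theorem1 (V : finType) (adj : rel V) (hG : simple_graph adj)
    (lam : V -> nat) (hlam : forall v : V, (0 < lam v)%N) :
  exists! chi : {poly Qq},
    forall n : nat, (0 < n)%N -> chi.[qint n] = q_chromatic adj lam n.
Proof.
have [p pP] := partial_chromatic_poly q_exp_neq1 adj setT hlam.
pose chi := p \Po (1%:P - (1 - q) *: 'X).
have chiE n : chi.[qint n.+1] = q_chromatic adj lam n.+1.
  rewrite horner_comp !(hornerD, hornerN, hornerZ, hornerX, hornerC) -q_exp_qint -pP.
  exact: partial_chromatic_setT.
exists chi; split=> [[//|n] _|r rP]; first exact: chiE.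
(* The shifted index samples only positive [n]; these points are distinct because [qint n]
   determines [q ^+ n]. *)
apply: (@poly_eq_on_injective_seq _ (fun n => qint n.+1)) => [m n eq_mn|n].
  have/q_exp_inj[] // : q ^+ m.+1 = q ^+ n.+1.
  by rewrite !q_exp_qint eq_mn.
by rewrite chiE rP.
Qed.
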